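(* Let $\{x^k\}$, $\{\alpha_k\}$ be generated by the general AdaBB algorithm (see context) from some $x^0\in\mathbb{R}^n$, $\alpha_0>0$, $\theta_0\ge 0$. For $k\ge 1$ define $$\bar x^{k}=\frac{(\alpha_k+P_k)x^{k}+\sum_{i=1}^{k-1}w_i x^{i}}{S_k},\qquad S_k=P_1+\sum_{i=1}^k\alpha_i .$$ Then for all $k\ge 1$ $$f(\bar x^{k})-f_*\le \frac{\varPhi_1}{2S_k}=O\left(\frac1k\right).$$
   Context: $\|\cdot\|$ is the Euclidean norm and $B(x,r)$ the closed ball with center $x$ and radius $r$. $f:\mathbb{R}^n\to\mathbb{R}$ is convex and differentiable with locally Lipschitz gradient; its set of minimizers $\mathcal{X}^*$ is nonempty, $f_*=\min f$, and $x^*\in\mathcal{X}^*$ is fixed. General AdaBB algorithm. Input $x^0\in\mathbb{R}^n$, $\alpha_0>0$, $\theta_0\ge0$. Set $x^1=x^0-\alpha_0\nabla f(x^0)$. For $k=1,2,\dots$ let $$\lambda_k=\frac{\langle\nabla f(x^k)-\nabla f(x^{k-1}),x^k-x^{k-1}\rangle}{\|\nabla f(x^k)-\nabla f(x^{k-1})\|^2}.$$ (Case i) If $\lambda_k\ge\alpha_{k-1}$: $\alpha_k=\sqrt{1+\theta_{k-1}}\,\alpha_{k-1}$ and $\theta_k=\alpha_k/\alpha_{k-1}$. (Case ii) If $\alpha_{k-1}/2<\lambda_k<\alpha_{k-1}$: $\alpha_k=\min\left\{\sqrt{\frac{\lambda_k}{2(\alpha_{k-1}-\lambda_k)}},\sqrt{\frac{(1+\theta_{k-1})\lambda_k}{2\lambda_k-\alpha_{k-1}}}\right\}\alpha_{k-1}$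 (Option I) or $\alpha_k=\lambda_k$ (Option II), and $\theta_k=\frac{2\alpha_k}{\alpha_{k-1}}-\frac{\alpha_k}{\lambda_k}$. (Case iii) If $\lambda_k\le\alpha_{k-1}/2$: $\alpha_k=\sqrt{\frac{\alpha_{k-1}}{2(\alpha_{k-1}-\lambda_k)}}\,\lambda_k$ (Option I) or $\alpha_k=\lambda_k/\sqrt2$ (Option II), and $\theta_k=\alpha_k/\alpha_{k-1}$. Then $x^{k+1}=x^k-\alpha_k\nabla f(x^k)$. In each of Cases ii and iii either option may be selected. It is assumed that $\nabla f(x^k)\ne\nabla f(x^{k-1})$ for all $k\ge1$, so that $\lambda_k$ is well defined. For $k\ge1$ define - $M_k=0$, $P_k=\frac{\alpha_k^2}{\alpha_{k-1}}$ if $\lambda_k\ge\alpha_{k-1}$; - $M_k=\frac{\alpha_k^2}{\lambda_k\alpha_{k-1}}-\frac{\alpha_k^2}{\alpha_{k-1}^2}$, $P_k=\frac{2\alpha_k^2}{\alpha_{k-1}}-\frac{\alpha_k^2}{\lambda_k}$ if $\frac{\alpha_{k-1}}2<\lambda_k<\alpha_{k-1}$; - $M_k=\frac{\alpha_k^2}{\lambda_k^2}-\frac{\alpha_k^2}{\alpha_{k-1}\lambda_k}$, $P_k=\frac{\alpha_k^2}{\alpha_{k-1}}$ if $0<\lambda_k\le\frac{\alpha_{k-1}}2$; and $P_0=P_1-\alpha_0$. For $k\ge0$ let $w_k=\alpha_k+P_k-P_{k+1}$ (so $w_0=0$). For $k\ge1$ let $$\varUpsilon_k=\|x^k-x^*\|^2+2M_k\|x^k-x^{k-1}\|^2+(2\alpha_{k-1}+2P_{k-1})(f(x^{k-1})-f_*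 ),\qquad \varPhi_k=\varUpsilon_k-2w_{k-1}(f(x^{k-1})-f_* ).$$ Local smoothness: there is $L>0$ with $f(x)-f(y)-\langle\nabla f(y),x-y\rangle\ge\frac1{2L}\|\nabla f(x)-\nabla f(y)\|^2$ for all $x,y\in B(x^*,R)$, where $R^2=\|x^0-x^*\|^2+\alpha_0^2(1+2M_1)\|\nabla f(x^0)\|^2+\max\{2P_1-2\alpha_0,0\}(f(x^0)-f_* )$. $O(\cdot)$ is as $k\to\infty$, with constants independent of $k$. *)

(* Defs.v *)
From HB Require Import structures.
From mathcomp Require Import all_boot all_order all_algebra.
From mathcomp Require Import all_classical all_reals all_analysis.

Set Implicit Arguments.
Unset Strict Implicit.
Unset Printing Implicit Defensive.

Import Order.TTheory GRing.Theory Num.Theory.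
Import numFieldNormedType.Exports.

Local Open Scope classical_set_scope.
Local Open Scope ring_scope.

(* The library norm on row vectors is the sup norm, which induces the same
   topology (hence the same notion of differentiability) as the Euclidean
   norm [enorm]. *)
Definition dotp (R : realType) (n : nat) (u v : 'rV[R]_n) : R :=
  \sum_(i < n) u 0 i * v 0 i.

Definition enorm (R : realType) (n : nat) (u : 'rV[R]_n) : R :=
  Num.sqrt (dotp u u).

Definition eball (R : realType) (n : nat) (x : 'rV[R]_n) (r : R) :
    set 'rV[R]_n :=
  closed_ball_ (@enorm R n) x r.

Definition grad (R : realType) (n : nat) (f : 'rV[R]_n -> R) (x : 'rV[R]_n) :
    'rV[R]_n :=
  \row_(i < n) 'D_(delta_mx 0 i) f x.

Definition locally_lipschitz (R : realType) (n : nat)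
    (g : 'rV[R]_n -> 'rV[R]_n) : Prop :=
  forall x, exists r K : R, 0 < r /\
    forall y z, eball x r y -> eball x r z ->
      enorm (g y - g z) <= K * enorm (y - z).

Definition minimizers (R : realType) (n : nat) (f : 'rV[R]_n -> R) :
    set 'rV[R]_n :=
  [set x | forall y, f x <= f y].

Definition smooth_on (R : realType) (n : nat) (f : 'rV[R]_n -> R)
    (A : set 'rV[R]_n) (L : R) : Prop :=
  forall x y, A x -> A y ->
    f x - f y - dotp (grad f y) (x - y)
      >= (2 * L)^-1 * enorm (grad f x - grad f y) ^+ 2.

(* Meaningful for [1 <= k] only. *)
Definition bb_lambda (R : realType) (n : nat) (f : 'rV[R]_n -> R)
    (x : nat -> 'rV[R]_n) (k : nat) : R :=
  dotp (grad f (x k) - grad f (x k.-1)) (x k - x k.-1)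
    / enorm (grad f (x k) - grad f (x k.-1)) ^+ 2.

(* [adabb_step l a t a' t']: from [alpha_(k-1) = a], [theta_(k-1) = t] and
   [lambda_k = l], the values [alpha_k = a'] and [theta_k = t'] are admissible.
   The option is chosen anew at each iteration. *)
Variant adabb_step (R : realType) (l a t a' t' : R) : Prop :=
| AdaBB_i of
    a <= l &
    a' = Num.sqrt (1 + t) * a &
    t' = a' / a
| AdaBB_ii_optI of
    a / 2 < l < a &
    a' = Num.min (Num.sqrt (l / (2 * (a - l))))
                 (Num.sqrt ((1 + t) * l / (2 * l - a))) * a &
    t' = 2 * a' / a - a' / l
| AdaBB_ii_optII of
    a / 2 < l < a &
    a' = l &
    t' = 2 * a' / a - a' / l
| AdaBB_iii_optI of
    l <= a / 2 &
    a' = Num.sqrt (a / (2 * (a - l))) * l &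
    t' = a' / a
| AdaBB_iii_optII of
    l <= a / 2 &
    a' = l / Num.sqrt 2 &
    t' = a' / a.

(* The inputs of the algorithm are [x 0], [alpha 0] and [theta 0]. *)
Definition adabb (R : realType) (n : nat) (f : 'rV[R]_n -> R)
    (x : nat -> 'rV[R]_n) (alpha theta : nat -> R) : Prop :=
  [/\ 0 < alpha 0%N,
      0 <= theta 0%N,
      forall k, x k.+1 = x k - alpha k *: grad f (x k) &
      forall k, adabb_step (bb_lambda f x k.+1) (alpha k) (theta k)
                           (alpha k.+1) (theta k.+1)].

(* The last branches of [ada_M] and [ada_P] are intended for
   [0 < lambda_k <= alpha_(k-1) / 2]; [ada_M] is meaningful for [1 <= k] only. *)
Definition ada_M (R : realType) (n : nat) (f : 'rV[R]_n -> R)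
    (x : nat -> 'rV[R]_n) (alpha : nat -> R) (k : nat) : R :=
  let l := bb_lambda f x k in
  let a := alpha k.-1 in
  let a' := alpha k in
  if a <= l then 0
  else if a / 2 < l then a' ^+ 2 / (l * a) - a' ^+ 2 / a ^+ 2
  else a' ^+ 2 / l ^+ 2 - a' ^+ 2 / (a * l).

Definition ada_Ppos (R : realType) (n : nat) (f : 'rV[R]_n -> R)
    (x : nat -> 'rV[R]_n) (alpha : nat -> R) (k : nat) : R :=
  let l := bb_lambda f x k in
  let a := alpha k.-1 in
  let a' := alpha k in
  if a <= l then a' ^+ 2 / a
  else if a / 2 < l then 2 * a' ^+ 2 / a - a' ^+ 2 / l
  else a' ^+ 2 / a.

Definition ada_P (R : realType) (n : nat) (f : 'rV[R]_n -> R)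
    (x : nat -> 'rV[R]_n) (alpha : nat -> R) (k : nat) : R :=
  if k == 0%N then ada_Ppos f x alpha 1 - alpha 0%N else ada_Ppos f x alpha k.

Definition ada_w (R : realType) (n : nat) (f : 'rV[R]_n -> R)
    (x : nat -> 'rV[R]_n) (alpha : nat -> R) (k : nat) : R :=
  alpha k + ada_P f x alpha k - ada_P f x alpha k.+1.

(* Here and below [xstar] is a minimizer, so that [f_* = f xstar]. *)
Definition ada_Upsilon (R : realType) (n : nat) (f : 'rV[R]_n -> R)
    (xstar : 'rV[R]_n) (x : nat -> 'rV[R]_n) (alpha : nat -> R) (k : nat) : R :=
  enorm (x k - xstar) ^+ 2
  + 2 * ada_M f x alpha k * enorm (x k - x k.-1) ^+ 2
  + (2 * alpha k.-1 + 2 * ada_P f x alpha k.-1) * (f (x k.-1) - f xstar).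

Definition ada_Phi (R : realType) (n : nat) (f : 'rV[R]_n -> R)
    (xstar : 'rV[R]_n) (x : nat -> 'rV[R]_n) (alpha : nat -> R) (k : nat) : R :=
  ada_Upsilon f xstar x alpha k
  - 2 * ada_w f x alpha k.-1 * (f (x k.-1) - f xstar).

Definition ada_radius (R : realType) (n : nat) (f : 'rV[R]_n -> R)
    (xstar : 'rV[R]_n) (x : nat -> 'rV[R]_n) (alpha : nat -> R) : R :=
  Num.sqrt (enorm (x 0%N - xstar) ^+ 2
    + alpha 0%N ^+ 2 * (1 + 2 * ada_M f x alpha 1) * enorm (grad f (x 0%N)) ^+ 2
    + Num.max (2 * ada_P f x alpha 1 - 2 * alpha 0%N) 0
      * (f (x 0%N) - f xstar)).

Definition ada_S (R : realType) (n : nat) (f : 'rV[R]_n -> R)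
    (x : nat -> 'rV[R]_n) (alpha : nat -> R) (k : nat) : R :=
  ada_P f x alpha 1 + \sum_(1 <= i < k.+1) alpha i.

Definition ada_xbar (R : realType) (n : nat) (f : 'rV[R]_n -> R)
    (x : nat -> 'rV[R]_n) (alpha : nat -> R) (k : nat) : 'rV[R]_n :=
  (ada_S f x alpha k)^-1 *:
    ((alpha k + ada_P f x alpha k) *: x k
     + \sum_(1 <= i < k) ada_w f x alpha i *: x i).

(* Main.v *)
Require Import Defs.
From HB Require Import structures.
From mathcomp Require Import all_boot all_order all_algebra.
From mathcomp Require Import all_classical all_reals all_analysis.
From mathcomp Require Import ring lra.

Set Implicit Arguments.
Unset Strict Implicit.
Unset Printing Implicit Defensive.

Import Order.TTheory GRing.Theory Num.Theory.
Import numFieldNormedType.Exports.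

Local Open Scope classical_set_scope.
Local Open Scope ring_scope.

(** Write g_k for the gradient at x_k and d_k for f (x_k) - f_*.  The proof is a
    Lyapunov argument, the Lyapunov function being Phi.

    Expanding the square and using g_k . (x_k - x^* ) >= d_k (convexity) gives
      |x_(k+1) - x^*|^2 <= |x_k - x^*|^2 - 2 alpha_k d_k + alpha_k^2 |g_k|^2,
    so everything depends on controlling alpha_k^2 |g_k|^2.  The Barzilai-Borwein
    quotient lambda_k ties |g_k|^2 to g_k . g_(k-1) and |g_(k-1)|^2 by one linear
    equation.  M_k and P_k are the coefficients for which this equation (with
    Cauchy-Schwarz in Case iii) yields
      alpha_k^2 |g_k|^2 <= M_k |x_k - x_(k-1)|^2 + P_k alpha_(k-1) g_k . g_(k-1)
    ([step_gram_le]), and convexity bounds alpha_(k-1) g_k . g_(k-1) by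
    d_(k-1) - d_k ([gradient_decay]).  The stepsize rule is designed to give, in
    every case and for both options, the two bounds 2 M_(k+1) <= 1 and
    w_k >= 0, i.e. P_(k+1) <= (1 + theta_k) alpha_k = alpha_k + P_k for k >= 1
    ([step_M_le_half], [step_P_le], [step_P_theta]).  The first turns the estimate
    into Phi_(k+1) + 2 w_k d_k <= Phi_k ([Phi_decrease]).  Summing,
      (alpha_k + P_k) d_k + sum_(1 <= i < k) w_i d_i <= Phi_1 / 2,
    whose weights add up to S_k, so Jensen's inequality gives the bound at the
    averaged point ([xbar_gap_le]).

    Smoothness is only local.  The radius R is chosen so that the ball contains x_0
    and x_1 and that Phi_1 <= R^2; the later iterates satisfy
    |x_k - x^*|^2 <= Phi_1, so all of them stay where f is smooth with constant L,
    and there lambda_k >= 1/L.  But the descent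
    inequality needs lambda_k > 0, so confinement and descent are proved by one
    induction ([iterates_controlled]).  This induction also carries
    alpha_k >= min (alpha_0, 1/(2L)): a step never falls below the smaller of
    the previous one and lambda_k / 2 ([adabb_step_ge]).  Hence S_k grows at
    least linearly, which is the O(1/k) rate. *)

(** * Scalar analysis of one stepsize update *)

Section Stepsize.
Variable R : realType.
Implicit Types l a t A B C : R.

(** M_k and P_k as functions of lambda_k = l, alpha_(k-1) = a and alpha_k = a', so
    that each update can be studied apart from the sequence. *)
Definition step_M l a (a' : R) : R :=
  if a <= l then 0
  else if a / 2 < l then a' ^+ 2 / (l * a) - a' ^+ 2 / a ^+ 2
  else a' ^+ 2 / l ^+ 2 - a' ^+ 2 / (a * l).

Definition step_P l a (a' : R) : R :=
  if a <= l then a' ^+ 2 / a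
  else if a / 2 < l then 2 * a' ^+ 2 / a - a' ^+ 2 / l
  else a' ^+ 2 / a.

(** The sign of l is left free: nonnegativity of M_1 is what places x_0 in the
    ball, and only afterwards can lambda_1 > 0 be read off local smoothness. *)
Lemma step_M_ge0 l a a' : 0 < a -> 0 <= step_M l a a'.
Proof.
move=> a0; have a_ne0 := lt0r_neq0 a0.
rewrite /step_M; case: (leP a l) => // la; case: ifP => [l2|_].
  rewrite subr_ge0 ler_wpM2l ?sqr_ge0// lef_pV2 ?posrE ?mulr_gt0//; last by lra.
  by rewrite expr2 ler_wpM2r// ltW.
have [->|l_ne0] := eqVneq l 0; first by rewrite mulr0 expr0n !invr0 !mulr0 subr0.
have -> : a' ^+ 2 / l ^+ 2 - a' ^+ 2 / (a * l) = (a' / l) ^+ 2 * ((a - l) / a).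
  by field; apply/andP.
by rewrite mulr_ge0 ?sqr_ge0// divr_ge0 ?ltW// subr_gt0.
Qed.

(** Option I takes the largest a' that these upper bounds allow; the value of
    Option II is smaller and obeys the same bounds.  Through this lemma the
    estimates of M and P become independent of the option. *)
Lemma adabb_step_sqr l a t a' t' : 0 < a -> 0 <= t -> 0 < l ->
  adabb_step l a t a' t' ->
  [/\ a <= l -> a' ^+ 2 = (1 + t) * a ^+ 2,
      a / 2 < l < a -> 2 * (a - l) * a' ^+ 2 <= l * a ^+ 2 /\
                       (2 * l - a) * a' ^+ 2 <= (1 + t) * l * a ^+ 2 &
      l <= a / 2 -> 2 * (a - l) * a' ^+ 2 <= a * l ^+ 2].
Proof.
move=> a0 t0 l0.
have Ei : a <= l -> a / 2 < l < a -> False by move=> ? /andP[]; lra.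
have Eii : a / 2 < l < a -> l <= a / 2 -> False by move=> /andP[]; lra.
case=> [al -> _|/[dup] lii /andP[al la] -> _|/[dup] lii /andP[al la] -> _
       |la -> _|la -> _]; split=> h; try lra; try by case/andP: h; lra.
- by rewrite exprMn sqr_sqrtr//; lra.
- have d1 : 0 < 2 * (a - l) by lra.
  have d2 : 0 < 2 * l - a by lra.
  have n2 : 0 <= (1 + t) * l by rewrite mulr_ge0//; lra.
  rewrite exprMn; set m := Num.min _ _.
  have m0 : 0 <= m by rewrite le_min !sqrtr_ge0.
  split.
    have : m ^+ 2 <= l / (2 * (a - l)).
      rewrite -[leRHS]sqr_sqrtr; last by rewrite divr_ge0// ltW.
      by rewrite ler_pXn2r ?nnegrE ?sqrtr_ge0// ge_min lexx.
    rewrite ler_pdivlMr// => ml.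
    by rewrite mulrA ler_wpM2r ?sqr_ge0// mulrC.
  have : m ^+ 2 <= (1 + t) * l / (2 * l - a).
    rewrite -[leRHS]sqr_sqrtr; last by rewrite divr_ge0// ltW.
    by rewrite ler_pXn2r ?nnegrE ?sqrtr_ge0// ge_min lexx orbT.
  rewrite ler_pdivlMr// => ml.
  by rewrite mulrA ler_wpM2r ?sqr_ge0// mulrC.
- split; rewrite expr2 mulrA.
    have -> : 2 * (a - l) * l * l = l * (2 * (a - l) * l) by ring.
    by rewrite ler_wpM2l ?ltW//; nra.
  have -> : (2 * l - a) * l * l = l * ((2 * l - a) * l) by ring.
  have -> : (1 + t) * l * a ^+ 2 = l * ((1 + t) * a ^+ 2) by ring.
  rewrite ler_wpM2l ?ltW//.
  suff : 0 <= t * a ^+ 2 by nra.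
  by rewrite mulr_ge0 ?sqr_ge0.
- have d1 : 0 < 2 * (a - l) by lra.
  rewrite exprMn sqr_sqrtr; last by rewrite divr_ge0 ?ltW.
  by rewrite mulrA [2 * _ * (a / _)]mulrC divfK ?lt0r_neq0.
- rewrite exprMn exprVn sqr_sqrtr//.
  by have l2 := sqr_ge0 l; nra.
Qed.

(** A rule with a square root never shrinks a step by more than the factor
    sqrt (1/2) relative to the smaller of a and l; the rounder factor 1/2 is enough
    for the rate. *)
Lemma adabb_step_ge l a t a' t' : 0 < a -> 0 <= t -> 0 < l ->
  adabb_step l a t a' t' -> Num.min a (l / 2) <= a'.
Proof.
move=> a0 t0 l0.
have half_sqrt (u : R) : 1 / 2 <= u -> 1 / 2 <= Num.sqrt u.
  move=> hu; rewrite -[1/2](@ger0_norm _ (1 / 2))// ?divr_ge0// -sqrtr_sqr ler_sqrt; lra.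
have one_sqrt (u : R) : 1 <= u -> 1 <= Num.sqrt u.
  by move=> hu; rewrite -sqrtr1 ler_sqrt//; lra.
case=> [al -> _|/andP[al la] -> _|/andP[al la] -> _|la -> _|la -> _];
  rewrite ge_min; apply/orP.
- left; rewrite ler_peMl ?(ltW a0)//; apply: one_sqrt; lra.
- right; rewrite -[l / 2]mulrC -[leLHS]/(_ * _).
  apply: (@le_trans _ _ (1 / 2 * a)); first by lra.
  rewrite ler_wpM2r ?(ltW a0)// le_min; apply/andP; split; apply: half_sqrt.
    by rewrite ler_pdivlMr; nra.
  by rewrite ler_pdivlMr; nra.
- by right; lra.
- right; rewrite [l / 2]mulrC -[2^-1]mul1r ler_wpM2r ?(ltW l0)//.
  by apply: half_sqrt; rewrite ler_pdivlMr; lra.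
- right; rewrite ler_wpM2l ?(ltW l0)// lef_pV2 ?posrE ?sqrtr_gt0//.
  rewrite -[leRHS](@ger0_norm _ 2)// -sqrtr_sqr ler_sqrt; lra.
Qed.

Lemma adabb_step_gt0 l a t a' t' : 0 < a -> 0 <= t -> 0 < l ->
  adabb_step l a t a' t' -> 0 < a'.
Proof.
move=> a0 t0 l0 /(adabb_step_ge a0 t0 l0); apply: lt_le_trans.
by rewrite lt_min a0 divr_gt0.
Qed.

(** This explains the rule for theta: theta_k is the ratio P_k / alpha_k. *)
Lemma step_P_theta l a t a' t' : 0 < a -> 0 < l ->
  adabb_step l a t a' t' -> step_P l a a' = a' * t'.
Proof.
move=> a0 l0; have a_ne0 := lt0r_neq0 a0; have l_ne0 := lt0r_neq0 l0.
rewrite /step_P.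
case=> [al a'E ->|/andP[al la] a'E ->|/andP[al la] a'E ->|la a'E ->|la a'E ->].
- by rewrite al; field.
- by rewrite leNgt la/= al; field; apply/andP.
- by rewrite leNgt la/= al; field; apply/andP.
- by rewrite leNgt (_ : l < a)/= ?ltNge ?la/=; [field|lra].
- by rewrite leNgt (_ : l < a)/= ?ltNge ?la/=; [field|lra].
Qed.

Lemma step_P_gt0 l a a' : 0 < a -> 0 < l -> 0 < a' -> 0 < step_P l a a'.
Proof.
move=> a0 l0 a'0; have a2 : 0 < a' ^+ 2 by rewrite exprn_gt0.
have a_ne0 := lt0r_neq0 a0; have l_ne0 := lt0r_neq0 l0.
rewrite /step_P; case: ifP => _; first by rewrite divr_gt0.
case: ifP => h; last by rewrite divr_gt0.
have -> : 2 * a' ^+ 2 / a - a' ^+ 2 / l = a' ^+ 2 * (2 * l - a) / (a * l).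
  by field; apply/andP.
by rewrite divr_gt0 ?mulr_gt0//; lra.
Qed.

(** The bound that makes the averaging weights w_k nonnegative.  It is an equality
    in Case i and the reason for the second term of the minimum in Case ii. *)
Lemma step_P_le l a t a' t' : 0 < a -> 0 <= t -> 0 < l ->
  adabb_step l a t a' t' -> step_P l a a' <= (1 + t) * a.
Proof.
move=> a0 t0 l0 /(adabb_step_sqr a0 t0 l0)[ci cii ciii].
have a_ne0 := lt0r_neq0 a0; have l_ne0 := lt0r_neq0 l0.
rewrite /step_P; case: (leP a l) => [al|la].
  by rewrite ler_pdivrMr// ci// expr2 mulrA.
case: (ltP (a / 2) l) => [al|la2].
  have [|_ h] := cii; first by rewrite al.
  have -> : 2 * a' ^+ 2 / a - a' ^+ 2 / l = (2 * l - a) * a' ^+ 2 / (a * l).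
    by field; apply/andP.
  rewrite ler_pdivrMr ?mulr_gt0//; apply: le_trans h _.
  by rewrite le_eqVlt; apply/orP; left; apply/eqP; ring.
rewrite ler_pdivrMr//.
have h := ciii la2.
have l2 : l ^+ 2 <= a ^+ 2 by rewrite ler_pXn2r ?nnegrE ?ltW.
have : a * a' ^+ 2 <= a * a ^+ 2.
  apply: (@le_trans _ _ (2 * (a - l) * a' ^+ 2)).
    by rewrite ler_wpM2r ?sqr_ge0//; lra.
  by apply: le_trans h _; rewrite ler_wpM2l// ltW.
rewrite ler_pM2l// => /le_trans; apply.
by have := mulr_ge0 t0 (sqr_ge0 a); nra.
Qed.

(** In Case ii this is the reason for the first term of the minimum, and in
    Case iii it fixes the stepsize: Option I attains equality there. *)
Lemma step_M_le_half l a t a' t' : 0 < a -> 0 <= t -> 0 < l ->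
  adabb_step l a t a' t' -> 2 * step_M l a a' <= 1.
Proof.
move=> a0 t0 l0 /(adabb_step_sqr a0 t0 l0)[_ cii ciii].
have a_ne0 := lt0r_neq0 a0; have l_ne0 := lt0r_neq0 l0.
rewrite /step_M; case: (leP a l) => [al|la]; first by rewrite mulr0.
case: (ltP (a / 2) l) => [al|la2].
  have [|h _] := cii; first by rewrite al.
  have -> : 2 * (a' ^+ 2 / (l * a) - a' ^+ 2 / a ^+ 2)
          = 2 * (a - l) * a' ^+ 2 / (l * a ^+ 2) by field; apply/andP.
  by rewrite ler_pdivrMr ?mul1r// mulr_gt0// exprn_gt0.
have -> : 2 * (a' ^+ 2 / l ^+ 2 - a' ^+ 2 / (a * l))
        = 2 * (a - l) * a' ^+ 2 / (a * l ^+ 2) by field; apply/andP.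
by rewrite ler_pdivrMr ?mul1r ?ciii// mulr_gt0// exprn_gt0.
Qed.

(** Here A, B, C stand for |g_k|^2, g_k . g_(k-1), |g_(k-1)|^2, and the last
    hypothesis is the definition of lambda_k.  In Case ii the claim is exactly
    that equation solved for A; in Case i it says A <= B; in Case iii replacing
    the nonpositive coefficient 2 - a/l of B by 1 costs an extra multiple
    of C, which the larger M pays for. *)
Lemma step_gram_le l a a' A B C : 0 < a -> 0 < l ->
    0 <= A -> 0 <= C -> B ^+ 2 <= A * C -> 0 <= A - 2 * B + C ->
    a * (C - B) = l * (A - 2 * B + C) ->
  a' ^+ 2 * A <= step_M l a a' * a ^+ 2 * C + step_P l a a' * a * B.
Proof.
move=> a0 l0 A0 C0 BAC D0 lE.
have a_ne0 := lt0r_neq0 a0; have l_ne0 := lt0r_neq0 l0.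
rewrite /step_M /step_P; case: (leP a l) => [al|la].
  rewrite !mul0r add0r divfK// ler_wpM2l ?sqr_ge0//.
  have : a * (A - B) <= 0 by nra.
  by rewrite pmulr_rle0// subr_le0.
have lA : l * A = (a - l) * C + (2 * l - a) * B by lra.
case: (ltP (a / 2) l) => [al|la2].
  rewrite le_eqVlt; apply/orP; left; apply/eqP.
  have -> : A = ((a - l) * C + (2 * l - a) * B) / l by rewrite -lA mulrC mulKf.
  by field; apply/andP.
have -> : (a' ^+ 2 / l ^+ 2 - a' ^+ 2 / (a * l)) * a ^+ 2 * C + a' ^+ 2 / a * a * B
  = a' ^+ 2 * (((a - l) * a * C + l ^+ 2 * B) / l ^+ 2) by field; apply/andP.
rewrite ler_wpM2l ?sqr_ge0// ler_pdivlMr ?exprn_gt0//.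
have -> : A * l ^+ 2 = l * ((a - l) * C + (2 * l - a) * B) by rewrite -lA; ring.
(* Solving for A in Cauchy-Schwarz leaves a quadratic inequality in B / C with
   roots 1 and 1 - a / l, so B is at least (1 - a / l) C. *)
suff key : - (l * B) <= (a - l) * C.
  have : 0 <= (a - l) * ((a - l) * C + l * B) by rewrite mulr_ge0; lra.
  move=> h; rewrite -subr_ge0; apply: (le_trans h); rewrite le_eqVlt; apply/orP; left; apply/eqP; ring.
have [B0|B0] := leP 0 B.
  have : 0 <= l * B by rewrite mulr_ge0// ltW.
  have : 0 <= (a - l) * C by rewrite mulr_ge0//; lra.
  by lra.
have CB : 0 < C - B by lra.
have : 0 <= (C - B) * ((a - l) * C + l * B).
  have -> : (C - B) * ((a - l) * C + l * B) = l * A * C - l * B ^+ 2 by rewrite lA; ring.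
  by rewrite -mulrA -mulrBr mulr_ge0 ?subr_ge0// ltW.
by rewrite pmulr_rge0//; lra.
Qed.

End Stepsize.

(** * Euclidean inner product *)

Section Euclidean.
Variables (R : realType) (n : nat).
Implicit Types (u v w : 'rV[R]_n) (c : R).

Lemma dotpC u v : dotp u v = dotp v u.
Proof. by apply: eq_bigr => i _; rewrite mulrC. Qed.

Lemma dotpDl u v w : dotp (u + v) w = dotp u w + dotp v w.
Proof. by rewrite -big_split; apply: eq_bigr => i _; rewrite mxE mulrDl. Qed.

Lemma dotpZl c u v : dotp (c *: u) v = c * dotp u v.
Proof. by rewrite /dotp mulr_sumr; apply: eq_bigr => i _; rewrite mxE mulrA. Qed.

Lemma dotpNl u v : dotp (- u) v = - dotp u v.
Proof. by rewrite -scaleN1r dotpZl mulN1r. Qed.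

Lemma dotpDr u v w : dotp u (v + w) = dotp u v + dotp u w.
Proof. by rewrite dotpC dotpDl !(dotpC u). Qed.

Lemma dotpZr c u v : dotp u (c *: v) = c * dotp u v.
Proof. by rewrite dotpC dotpZl dotpC. Qed.

Lemma dotpNr u v : dotp u (- v) = - dotp u v.
Proof. by rewrite dotpC dotpNl dotpC. Qed.

Definition dotpE := (dotpDl, dotpDr, dotpNl, dotpNr, dotpZl, dotpZr).

Lemma dotp_ge0 u : 0 <= dotp u u.
Proof. by apply: sumr_ge0 => i _; rewrite -expr2 sqr_ge0. Qed.

Lemma dotp_eq0 u : (dotp u u == 0) = (u == 0).
Proof.
apply/idP/eqP => [|->]; last by rewrite /dotp big1// => i _; rewrite mxE mul0r.
rewrite psumr_eq0; last by move=> i _; rewrite -expr2 sqr_ge0.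
move=> /allP h; apply/rowP => i; rewrite mxE.
by have /(_ (mem_index_enum i)) := h i; rewrite mulf_eq0 orbb => /eqP.
Qed.

Lemma enorm_sqr u : enorm u ^+ 2 = dotp u u.
Proof. by rewrite sqr_sqrtr// dotp_ge0. Qed.

(** From the nonnegativity of the square of |v|^2 u - (u . v) v. *)
Lemma cauchy_schwarz_dotp u v : dotp u v ^+ 2 <= dotp u u * dotp v v.
Proof.
have [/eqP|v_ne0] := eqVneq (dotp v v) 0.
  rewrite dotp_eq0 => /eqP ->.
  have -> : dotp u 0 = 0 by rewrite -(scale0r 0) dotpZr mul0r.
  by rewrite expr0n/= mulr_ge0 ?dotp_ge0.
have v_gt0 : 0 < dotp v v by rewrite lt0r v_ne0 dotp_ge0.
have := dotp_ge0 (dotp v v *: u - dotp u v *: v).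
rewrite !dotpE (dotpC v u).
set A := dotp u u; set B := dotp u v; set C := dotp v v in v_gt0 *.
move=> h; have : 0 <= C * (A * C - B ^+ 2).
  by apply: (le_trans h); rewrite le_eqVlt; apply/orP; left; apply/eqP; ring.
by rewrite pmulr_rge0// subr_ge0.
Qed.

End Euclidean.

(** * Convex differentiable functions *)

Section ConvexGradient.
Variables (R : realType) (n : nat) (f : 'rV[R]_n -> R).
Hypothesis f_convex : convex_function [set: convex_lmodType 'rV[R]_n] f.
Hypothesis f_diff : forall y, differentiable f y.

Lemma deriveE_grad x v : 'D_v f x = dotp (grad f x) v.
Proof.
rewrite deriveE// [in LHS](row_sum_delta v) linear_sum/=.
by apply: eq_bigr => i _; rewrite linearZ/= mxE deriveE// mulrC.
Qed.

(** By convexity the difference quotients along y - x are at most f y - f x for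
    steps in ]0, 1]; let the step tend to 0 from the right. *)
Lemma convex_ge_tangent x y : f x + dotp (grad f x) (y - x) <= f y.
Proof.
rewrite -deriveE_grad addrC -lerBrDr.
have dfx : derivable f x (y - x) by exact: diff_derivable.
apply: (@cvgr_to_le _ _ _ _ _ _ _ (cvg_dnbhs_at_right dfx)).
near=> h => /=.
have h0 : 0 < h by near: h; exact: nbhs_right_gt.
have h1 : h <= 1 by near: h; exact: nbhs_right_le.
have := @f_convex (Itv01 (ltW h0) h1) y x; rewrite !inE => /(_ Logic.I Logic.I).
rewrite !convRE/= /conv/= /unstable.onem => fh.
rewrite /GRing.scale/= mulrC ler_pdivrMr//.
have -> : h *: (y - x) + x = h *: y + (1 - h) *: x.
  by rewrite scalerBr scalerBl scale1r addrAC addrA.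
rewrite lerBlDr; apply: le_trans fh _.
by rewrite le_eqVlt; apply/orP; left; apply/eqP; ring.
Unshelve. all: by end_near.
Qed.

(** Jensen's inequality for unnormalized weights: sum the tangent inequalities at
    the weighted mean v, where the linear terms cancel. *)
Lemma jensen_weighted (I : Type) (r : seq I) (w : I -> R) (z : I -> 'rV[R]_n)
    (W : R) (v : 'rV[R]_n) :
  W *: v = \sum_(i <- r) w i *: z i -> W = \sum_(i <- r) w i ->
  (forall i, 0 <= w i) ->
  W * f v <= \sum_(i <- r) w i * f (z i).
Proof.
move=> Wv WE w0.
have : \sum_(i <- r) w i * (f v + dotp (grad f v) (z i - v))
       <= \sum_(i <- r) w i * f (z i).
  by apply: ler_sum => i _; rewrite ler_wpM2l// convex_ge_tangent.
apply: le_trans; under eq_bigr do rewrite mulrDr -dotpZr.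
rewrite big_split/= -mulr_suml -WE.
have <- : dotp (grad f v) (\sum_(i <- r) w i *: (z i - v)) =
       \sum_(i <- r) dotp (grad f v) (w i *: (z i - v)).
  apply: (big_morph (dotp (grad f v))); first by move=> a b; rewrite dotpDr.
  by rewrite -(scale0r 0) dotpZr mul0r.
under eq_bigr do rewrite scalerBr.
rewrite sumrB -Wv -scaler_suml -WE subrr.
by rewrite -(scale0r 0) dotpZr mul0r addr0.
Qed.

End ConvexGradient.

(** Add the smoothness inequalities for (x, y) and (y, x). *)
Lemma cocoercive_grad (R : realType) (n : nat) (f : 'rV[R]_n -> R) A (L : R) :
  smooth_on f A L -> forall x y, A x -> A y ->
  L^-1 * enorm (grad f x - grad f y) ^+ 2
  <= dotp (grad f x - grad f y) (x - y).
Proof.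
move=> sm x y Ax Ay; have := sm _ _ Ax Ay; have := sm _ _ Ay Ax.
rewrite !enorm_sqr invfM !dotpE (dotpC (grad f y) (grad f x)).
by lra.
Qed.

(** * Descent of the Lyapunov function along the iterates *)

Section Descent.
Variables (R : realType) (n : nat) (f : 'rV[R]_n -> R) (xstar : 'rV[R]_n).
Variables (x : nat -> 'rV[R]_n) (alpha theta : nat -> R).
Hypothesis f_convex : convex_function [set: convex_lmodType 'rV[R]_n] f.
Hypothesis f_diff : forall y, differentiable f y.
Hypothesis xstar_min : minimizers f xstar.
Hypothesis x_adabb : adabb f x alpha theta.

Local Notation g k := (grad f (x k)).
Local Notation lam := (bb_lambda f x).
Local Notation M := (ada_M f x alpha).
Local Notation P := (ada_P f x alpha).
Local Notation w := (ada_w f x alpha).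
Local Notation Phi := (ada_Phi f xstar x alpha).
Local Notation gap k := (f (x k) - f xstar).
Local Notation dist2 k := (enorm (x k - xstar) ^+ 2).

Lemma gap_ge0 k : 0 <= gap k.
Proof. by rewrite subr_ge0. Qed.

Lemma gap_le_dotp k : gap k <= dotp (g k) (x k - xstar).
Proof.
have := convex_ge_tangent f_convex f_diff (x k) xstar.
by rewrite -opprB dotpNr; lra.
Qed.

Lemma iterate_succ k : x k.+1 = x k - alpha k *: g k.
Proof. by case: x_adabb. Qed.

Lemma iterate_diff k : x k.+1 - x k = - (alpha k *: g k).
Proof. by rewrite iterate_succ addrC addKr. Qed.

Lemma dist2_succ k : 0 <= alpha k ->
  dist2 k.+1 <= dist2 k - 2 * alpha k * gap k
                + alpha k ^+ 2 * enorm (g k) ^+ 2.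
Proof.
move=> ak0.
have -> : x k.+1 - xstar = (x k - xstar) - alpha k *: g k.
  by rewrite iterate_succ addrAC.
rewrite !enorm_sqr; move: (gap_le_dotp k).
move: (x k - xstar) => u; rewrite !dotpE (dotpC u (g k)) => h.
by have := ler_wpM2l ak0 h; lra.
Qed.

Lemma ada_ME k : M k.+1 = step_M (lam k.+1) (alpha k) (alpha k.+1).
Proof. by []. Qed.

Lemma ada_PE k : P k.+1 = step_P (lam k.+1) (alpha k) (alpha k.+1).
Proof. by []. Qed.

(** Subtracting w_k turns the coefficient alpha_k + P_k of Upsilon into P_(k+1),
    the one that [gradient_decay] produces. *)
Lemma ada_PhiE k : Phi k.+1 = dist2 k.+1
  + 2 * M k.+1 * enorm (x k.+1 - x k) ^+ 2 + 2 * P k.+1 * gap k.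
Proof. by rewrite /ada_Phi /ada_Upsilon /ada_w /=; ring. Qed.

(** Since x_(k+1) - x_k = - alpha_k g_k, the quotient lambda_(k+1) involves only
    the three inner products of g_k and g_(k+1). *)
Lemma bb_lambdaE k : grad f (x k.+1) <> grad f (x k) ->
  lam k.+1 * (dotp (g k.+1) (g k.+1) - 2 * dotp (g k.+1) (g k)
              + dotp (g k) (g k))
  = alpha k * (dotp (g k) (g k) - dotp (g k.+1) (g k)).
Proof.
move=> g_ne; have D_ne0 : dotp (g k.+1 - g k) (g k.+1 - g k) != 0.
  by rewrite dotp_eq0 subr_eq0; apply/eqP.
have -> : dotp (g k.+1) (g k.+1) - 2 * dotp (g k.+1) (g k) + dotp (g k) (g k)
    = dotp (g k.+1 - g k) (g k.+1 - g k).
  by rewrite !dotpE (dotpC (g k)); ring.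
rewrite /bb_lambda/= enorm_sqr divfK// iterate_diff !dotpE.
by ring.
Qed.

Lemma gradient_decay k : grad f (x k.+1) <> grad f (x k) ->
  0 < alpha k -> 0 < lam k.+1 -> 0 < alpha k.+1 ->
  alpha k.+1 ^+ 2 * enorm (g k.+1) ^+ 2
  <= M k.+1 * enorm (x k.+1 - x k) ^+ 2 + P k.+1 * (gap k - gap k.+1).
Proof.
move=> g_ne a0 l0 a'0.
apply: (@le_trans _ _ (M k.+1 * alpha k ^+ 2 * dotp (g k) (g k)
                       + P k.+1 * alpha k * dotp (g k.+1) (g k))).
  rewrite enorm_sqr ada_ME ada_PE; apply: step_gram_le => //.
  - exact: dotp_ge0.
  - exact: dotp_ge0.
  - exact: cauchy_schwarz_dotp.
  - have := dotp_ge0 (g k.+1 - g k).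
    by rewrite !dotpE (dotpC (g k)); lra.
  - by rewrite bb_lambdaE.
rewrite enorm_sqr iterate_diff !dotpE.
have := convex_ge_tangent f_convex f_diff (x k.+1) (x k).
rewrite -opprB iterate_diff opprK dotpZr => h.
have P0 : 0 <= P k.+1 by rewrite ada_PE ltW// step_P_gt0.
have := ler_wpM2l P0 (_ : alpha k * dotp (g k.+1) (g k) <= gap k - gap k.+1).
by move/(_ ltac:(lra)); lra.
Qed.

(** Apart from the factor 1 + 2 M_(k+2) this is already the decrease of Phi.  It is
    stated without lambda_(k+2), whose positivity is known only once x_(k+2) is
    known to lie in the ball, which in turn follows from this inequality. *)
Lemma lyapunov_step k : grad f (x k.+1) <> grad f (x k) ->
  0 < alpha k -> 0 < lam k.+1 -> 0 < alpha k.+1 ->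
  dist2 k.+2 + enorm (x k.+2 - x k.+1) ^+ 2
    + 2 * (alpha k.+1 + P k.+1) * gap k.+1 <= Phi k.+1.
Proof.
move=> g_ne a0 l0 a'0.
have h := gradient_decay g_ne a0 l0 a'0.
have h' := dist2_succ (ltW a'0).
rewrite ada_PhiE [in X in X <= _]iterate_diff.
have -> : enorm (- (alpha k.+1 *: g k.+1)) ^+ 2
        = alpha k.+1 ^+ 2 * enorm (g k.+1) ^+ 2.
  by rewrite !enorm_sqr !dotpE; ring.
by lra.
Qed.

Lemma Phi_decrease k : grad f (x k.+1) <> grad f (x k) ->
  0 < alpha k -> 0 < lam k.+1 -> 0 < alpha k.+1 ->
  0 <= theta k.+1 -> 0 < lam k.+2 ->
  Phi k.+2 + 2 * w k.+1 * gap k.+1 <= Phi k.+1.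
Proof.
move=> g_ne a0 l0 a'0 t'0 l'0; have h := lyapunov_step g_ne a0 l0 a'0.
have [_ _ _ /(_ k.+1) st] := x_adabb.
have M1 := step_M_le_half a'0 t'0 l'0 st; rewrite -ada_ME in M1.
have := ler_wpM2r (sqr_ge0 (enorm (x k.+2 - x k.+1))) M1.
by rewrite (ada_PhiE k.+1) /ada_w; lra.
Qed.

Lemma w_ge0_of_step k : 0 < alpha k -> 0 < lam k.+1 -> 0 < alpha k.+1 ->
  0 <= theta k.+1 -> 0 < lam k.+2 -> 0 <= w k.+1.
Proof.
move=> a0 l0 a'0 t'0 l'0; have [_ _ _ st] := x_adabb.
rewrite /ada_w subr_ge0 ada_PE (ada_PE k) (step_P_theta a0 l0 (st k)).
by apply: le_trans (step_P_le a'0 t'0 l'0 (st k.+1)) _; lra.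
Qed.

Lemma theta_ge0 k : 0 < alpha k -> 0 < lam k.+1 -> 0 < alpha k.+1 ->
  0 <= theta k.+1.
Proof.
move=> a0 l0 a'0; have [_ _ _ /(_ k) st] := x_adabb.
have := step_P_gt0 a0 l0 a'0; rewrite (step_P_theta a0 l0 st).
by rewrite pmulr_rgt0// => /ltW.
Qed.

(** Comparing squares avoids proving that the expression under the square root
    in the radius is nonnegative. *)
Lemma mem_eball_radius y : dotp (y - xstar) (y - xstar) <=
    dist2 0%N + alpha 0%N ^+ 2 * (1 + 2 * M 1) * enorm (g 0%N) ^+ 2
    + Num.max (2 * P 1 - 2 * alpha 0%N) 0 * gap 0%N ->
  eball xstar (ada_radius f xstar x alpha) y.
Proof.
move=> h; rewrite /eball /closed_ball_ /= /enorm -opprB dotpNl dotpNr opprK.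
exact: ler_wsqrtr.
Qed.

Lemma x0_in_ball : eball xstar (ada_radius f xstar x alpha) (x 0%N).
Proof.
have [a0 _ _ _] := x_adabb.
apply: mem_eball_radius; rewrite -enorm_sqr -addrA lerDl addr_ge0//.
  have M0 : 0 <= M 1 by rewrite ada_ME step_M_ge0.
  by rewrite mulr_ge0 ?sqr_ge0// mulr_ge0 ?sqr_ge0//; lra.
by rewrite mulr_ge0 ?gap_ge0// le_max lexx orbT.
Qed.

(** Not a consequence of [Phi1_in_ball]: that Phi_1 dominates the distance of x_1
    uses P_1 > 0, hence lambda_1 > 0, hence that x_1 is in the ball. *)
Lemma x1_in_ball : eball xstar (ada_radius f xstar x alpha) (x 1%N).
Proof.
have [a0 _ _ _] := x_adabb.
apply: mem_eball_radius; rewrite -enorm_sqr; apply: le_trans (dist2_succ (ltW a0)) _.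
have M0 : 0 <= M 1 by rewrite ada_ME step_M_ge0.
have := mulr_ge0 M0 (mulr_ge0 (sqr_ge0 (alpha 0%N)) (sqr_ge0 (enorm (g 0%N)))).
have := mulr_ge0 (ltW a0) (gap_ge0 0).
have : 0 <= Num.max (2 * P 1 - 2 * alpha 0%N) 0 * gap 0%N.
  by rewrite mulr_ge0 ?gap_ge0// le_max lexx orbT.
by lra.
Qed.

Lemma Phi1_in_ball y : dotp (y - xstar) (y - xstar) <= Phi 1 ->
  eball xstar (ada_radius f xstar x alpha) y.
Proof.
have [a0 _ _ _] := x_adabb.
move=> h; apply: mem_eball_radius; apply: (le_trans h).
rewrite ada_PhiE iterate_diff.
have -> : enorm (- (alpha 0%N *: g 0%N)) ^+ 2
        = alpha 0%N ^+ 2 * enorm (g 0%N) ^+ 2.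
  by rewrite !enorm_sqr !dotpE; ring.
have := dist2_succ (ltW a0).
have : (2 * P 1 - 2 * alpha 0%N) * gap 0%N
       <= Num.max (2 * P 1 - 2 * alpha 0%N) 0 * gap 0%N.
  by rewrite ler_wpM2r ?gap_ge0// le_max lexx.
by lra.
Qed.

Variable L : R.
Hypothesis grad_neq : forall k, grad f (x k.+1) <> grad f (x k).
Hypothesis L_gt0 : 0 < L.
Hypothesis f_smooth : smooth_on f (eball xstar (ada_radius f xstar x alpha)) L.

Local Notation B := (eball xstar (ada_radius f xstar x alpha)).

Lemma bb_lambda_ge k : B (x k) -> B (x k.+1) -> L^-1 <= lam k.+1.
Proof.
move=> Bk Bk1; have h := cocoercive_grad f_smooth Bk1 Bk.
have D0 : 0 < enorm (g k.+1 - g k) ^+ 2.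
  by rewrite enorm_sqr lt0r dotp_ge0 dotp_eq0 subr_eq0 andbT; apply/eqP.
by rewrite /bb_lambda/= ler_pdivlMr.
Qed.

Local Notation amin := (Num.min (alpha 0%N) (L^-1 / 2)).

Lemma amin_gt0 : 0 < amin.
Proof. by have [a0 _ _ _] := x_adabb; rewrite lt_min a0 divr_gt0 ?invr_gt0. Qed.

(** Two consecutive iterates in the ball give lambda_(k+1) >= 1/L, hence an
    admissible step alpha_(k+1); then [lyapunov_step] puts the next iterate in the
    ball, and [Phi_decrease] becomes available. *)
Lemma iterates_controlled k :
  [/\ amin <= alpha k, 0 <= theta k, B (x k), B (x k.+1) & Phi k.+1 <= Phi 1].
Proof.
have [a0 t0 _ st] := x_adabb.
elim: k => [|k [ak tk Bk Bk1 Phik]].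
  split=> //; [by rewrite ge_min lexx | exact: x0_in_ball | exact: x1_in_ball].
have ak0 := lt_le_trans amin_gt0 ak.
have lk := bb_lambda_ge Bk Bk1.
have lk0 : 0 < lam k.+1 by apply: lt_le_trans lk; rewrite invr_gt0.
have ak1 := adabb_step_gt0 ak0 tk lk0 (st k).
have tk1 := theta_ge0 ak0 lk0 ak1.
have Bk2 : B (x k.+2).
  apply: Phi1_in_ball; rewrite -enorm_sqr.
  apply: le_trans Phik; apply: le_trans (lyapunov_step (@grad_neq k) ak0 lk0 ak1).
  rewrite -addrA lerDl addr_ge0 ?sqr_ge0// mulr_ge0 ?gap_ge0//.
  have : 0 < P k.+1 by exact: step_P_gt0.
  by lra.
split=> //.
  apply: le_trans (adabb_step_ge ak0 tk lk0 (st k)).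
  rewrite le_min ak /= ge_min; apply/orP; right.
  by rewrite ler_wpM2r// invr_ge0.
have lk1 : 0 < lam k.+2.
  by apply: lt_le_trans (bb_lambda_ge Bk1 Bk2); rewrite invr_gt0.
apply: le_trans Phik.
apply: le_trans (Phi_decrease (@grad_neq k) ak0 lk0 ak1 tk1 lk1).
by rewrite lerDl !mulr_ge0 ?gap_ge0// w_ge0_of_step.
Qed.

Lemma alpha_gt0 k : 0 < alpha k.
Proof.
by have [ak _ _ _ _] := iterates_controlled k; apply: lt_le_trans ak; exact: amin_gt0.
Qed.

Lemma bb_lambda_gt0 k : 0 < lam k.+1.
Proof.
have [_ _ Bk Bk1 _] := iterates_controlled k.
by apply: lt_le_trans (bb_lambda_ge Bk Bk1); rewrite invr_gt0.
Qed.

Lemma ada_P_gt0 k : 0 < P k.+1.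
Proof. by apply: step_P_gt0; rewrite ?alpha_gt0 ?bb_lambda_gt0. Qed.

Lemma ada_w_ge0 k : 0 <= w k.
Proof.
case: k => [|k]; first by rewrite /ada_w /ada_P/= subrKC subrr.
have [_ tk _ _ _] := iterates_controlled k.+1.
by apply: w_ge0_of_step; rewrite ?alpha_gt0 ?bb_lambda_gt0.
Qed.

Lemma Phi_telescope k :
  Phi k.+1 + 2 * \sum_(1 <= i < k.+1) w i * gap i <= Phi 1.
Proof.
elim: k => [|k IH]; first by rewrite big_geq// mulr0 addr0.
apply: le_trans IH; rewrite big_nat_recr//=.
have [_ tk _ _ _] := iterates_controlled k.+1.
have := Phi_decrease (@grad_neq k) (alpha_gt0 k) (bb_lambda_gt0 k)
  (alpha_gt0 k.+1) tk (bb_lambda_gt0 k.+1).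
by lra.
Qed.

Lemma gap_sum_le k :
  2 * ((alpha k.+1 + P k.+1) * gap k.+1 + \sum_(1 <= i < k.+1) w i * gap i)
  <= Phi 1.
Proof.
have := Phi_telescope k.
have := lyapunov_step (@grad_neq k) (alpha_gt0 k) (bb_lambda_gt0 k) (alpha_gt0 k.+1).
have := sqr_ge0 (enorm (x k.+2 - xstar)).
have := sqr_ge0 (enorm (x k.+2 - x k.+1)).
by lra.
Qed.

(** Abel summation: the P_i in the weights w_i telescope. *)
Lemma ada_S_weights k :
  ada_S f x alpha k.+1
  = (alpha k.+1 + P k.+1) + \sum_(1 <= i < k.+1) w i.
Proof.
rewrite /ada_S; elim: k => [|k IH]; first by rewrite big_nat1 big_geq// addr0 addrC.
by rewrite big_nat_recr//= addrA IH [in RHS]big_nat_recr//= /ada_w; ring.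
Qed.

Lemma ada_S_ge k : amin * k%:R <= ada_S f x alpha k.
Proof.
have : amin * k%:R <= \sum_(1 <= i < k.+1) alpha i.
  have -> : amin * k%:R = \sum_(1 <= i < k.+1) amin.
    by rewrite big_const_nat iter_addr addr0 subn1 mulr_natr.
  by apply: ler_sum => i _; have [] := iterates_controlled i.
by move/le_trans; apply; rewrite /ada_S lerDr ltW// ada_P_gt0.
Qed.

Lemma ada_S_gt0 k : 0 < ada_S f x alpha k.
Proof.
apply: ltr_pwDl; first exact: ada_P_gt0.
by apply: sumr_ge0 => i _; rewrite ltW// alpha_gt0.
Qed.

Lemma xbar_gap_le k :
  f (ada_xbar f x alpha k.+1) - f xstar
  <= Phi 1 / (2 * ada_S f x alpha k.+1).
Proof.
have S0 := ada_S_gt0 k.+1.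
rewrite ler_pdivlMr ?mulr_gt0//; apply: le_trans (gap_sum_le k).
rewrite mulrC -mulrA ler_pM2l//.
(* The index None carries the last point, which has a weight of its own. *)
pose r := None :: [seq Some i | i <- index_iota 1 k.+1].
pose W o := if o is Some i then w i else alpha k.+1 + P k.+1.
pose z o := if o is Some i then x i else x k.+1.
have WE : ada_S f x alpha k.+1 = \sum_(o <- r) W o.
  by rewrite big_cons big_map ada_S_weights.
have := @jensen_weighted _ _ _ f_convex f_diff _ r W z _ (ada_xbar f x alpha k.+1) _ WE.
rewrite !big_cons !big_map /= => jensen.
rewrite mulrBr lerBlDr; apply: le_trans (jensen _ _) _.
- by rewrite /ada_xbar scalerA mulfV ?lt0r_neq0// scale1r.
- case=> [i|]; first exact: ada_w_ge0.
  by rewrite /= addr_ge0 ?ltW ?alpha_gt0 ?ada_P_gt0.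
under [in leRHS]eq_bigr do rewrite mulrBr.
rewrite sumrB -mulr_suml ada_S_weights.
by rewrite le_eqVlt; apply/orP; left; apply/eqP; ring.
Qed.

End Descent.

(** * The rate of convergence *)

Theorem theorem3p1 (R : realType) (n : nat) (f : 'rV[R]_n -> R)
    (xstar : 'rV[R]_n) (x : nat -> 'rV[R]_n) (alpha theta : nat -> R) (L : R)
    (f_convex : convex_function [set: convex_lmodType 'rV[R]_n] f)
    (f_diff : forall y : 'rV[R]_n, differentiable f y)
    (f_loclip : locally_lipschitz (grad f))
    (xstar_min : minimizers f xstar)
    (x_adabb : adabb f x alpha theta)
    (grad_neq : forall k : nat, (1 <= k)%N -> grad f (x k) <> grad f (x k.-1))
    (L_gt0 : 0 < L)
    (f_smooth : smooth_on f (eball xstar (ada_radius f xstar x alpha)) L) :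
  (forall k : nat, (1 <= k)%N ->
     f (ada_xbar f x alpha k) - f xstar
       <= ada_Phi f xstar x alpha 1 / (2 * ada_S f x alpha k)) /\
  (fun k : nat => ada_Phi f xstar x alpha 1 / (2 * ada_S f x alpha k))
    =O_\oo (fun k : nat => k%:R^-1 : R).
Proof.
have g_ne k : grad f (x k.+1) <> grad f (x k) by exact: (grad_neq k.+1).
split=> [[//|k] _|].
  exact: (xbar_gap_le f_convex f_diff xstar_min x_adabb g_ne L_gt0 f_smooth).
set Phi1 := ada_Phi _ _ _ _ _; pose c := Num.min (alpha 0%N) (L^-1 / 2).
have c0 : 0 < c by exact: (amin_gt0 x_adabb L_gt0).
apply/eqO_exP; exists (`|Phi1| / (2 * c) + 1).
  by rewrite ltr_wpDl// divr_ge0// mulr_ge0// ltW.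
near=> k.
have k0 : 0 < k%:R :> R by rewrite ltr0n; near: k; exact: nbhs_infty_gt.
have Sk := ada_S_ge f_convex f_diff xstar_min x_adabb g_ne L_gt0 f_smooth k.
have ck0 : 0 < c * k%:R by rewrite mulr_gt0.
have Sk0 := lt_le_trans ck0 Sk.
rewrite normrM [`|_^-1|]ger0_norm ?invr_ge0 ?mulr_ge0 ?(ltW Sk0)//.
rewrite [`|k%:R^-1|]ger0_norm ?invr_ge0//.
apply: (@le_trans _ _ (`|Phi1| / (2 * c) / k%:R)); last first.
  by rewrite ler_wpM2r ?invr_ge0// lerDl.
rewrite -mulrA -invfM -mulrA ler_wpM2l// lef_pV2 ?posrE ?mulr_gt0//.
by rewrite ler_pM2l.
Unshelve. all: by end_near.
Qed.
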